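(* Let $k > 1$ and $p > 1$ be integers. The cycle graph $C_{k^p+1}$ on $k^p+1$ vertices has weak periodicity number $p$ under the $k$-distance operator, i.e. $\varrho^k(C_{k^p+1}) = p$.
   Context: Graphs are simple and undirected; $d_G(u,v)$ denotes geodesic distance (length of a shortest path) in $G$. For $k>1$, the $k$-distance operator $D^k$ sends a graph $G$ to the graph $D^k(G)$ on the same vertex set in which $u,v$ are adjacent if and only if $d_G(u,v)=k$. Set $G_1^k = G$ and $G_t^k = D^k(G_{t-1}^k)$ for $t>1$ (so $G_t^k$ results from $t-1$ applications of $D^k$), all on the same labeled vertex set. Write $G \equiv H$ (labeled isomorphism) if $G$ and $H$ are isomorphic with the labels of their vertices preserved, i.e. they have the same vertex set and the same edge set. The weak periodicity number $\varrho^k(G)$ is $f-1$, where $f>1$ is the least integer such that $G_f^k \equiv G_1^k$; if no such $f$ exists, $\varrho^k(G)=0$. *)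

(* Defs.v *)
From mathcomp Require Import all_boot.
From mathcomp Require Import boolp.

Set Implicit Arguments.
Unset Strict Implicit.
Unset Printing Implicit Defensive.

Record sgraph (V : finType) := SGraph {
  adj :> rel V;
  adj_sym : symmetric adj;
  adj_irr : irreflexive adj }.

(* Labeled isomorphism: the vertex set is shared, so only the edges matter. *)
Definition labeled_iso (V : finType) (G H : sgraph V) : bool :=
  [forall u, forall v, G u v == H u v].

Definition has_path (V : finType) (G : sgraph V) (u v : V) (n : nat) : bool :=
  [exists s : n.-tuple V,
    [&& path G u s, last u s == v & uniq (u :: s)]].

(* [None] stands for the infinite distance between distinct components. *)
Definition dist (V : finType) (G : sgraph V) (u v : V) : option nat :=
  match pselect (exists n, has_path G u v n) with
  | left ex => Some (ex_minn ex)
  | right _ => None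
  end.

Lemma has_path_sym (V : finType) (G : sgraph V) (u v : V) (n : nat) :
  has_path G u v n = has_path G v u n.
Proof.
wlog suff H : u v / has_path G u v n -> has_path G v u n.
  by apply/idP/idP; apply: H.
case/existsP=> s /and3P [Gs /eqP <- us].
have sz : size (rev (belast u s)) == n by rewrite size_rev size_belast size_tuple.
apply/existsP; exists (Tuple sz) => /=; apply/and3P; split.
- by rewrite rev_path (eq_path (e' := G)) // => x y; rewrite adj_sym.
- case: (tval s) => [|x t] //=.
  by rewrite rev_cons last_rcons.
- by rewrite -[_ && _]/(uniq (_ :: _)) -rev_rcons -lastI rev_uniq.
Qed.

Lemma dist_sym (V : finType) (G : sgraph V) (u v : V) :
  dist G u v = dist G v u.
Proof.
rewrite /dist; have E n : has_path G u v n = has_path G v u n.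
  exact: has_path_sym.
case: pselect => [e1|n1]; case: pselect => [e2|n2] //.
- by congr Some; apply: eq_ex_minn.
- by case: n2; case: e1 => n; rewrite E; exists n.
- by case: n1; case: e2 => n; rewrite -E; exists n.
Qed.

Lemma dist_refl (V : finType) (G : sgraph V) (u : V) : dist G u u = Some 0.
Proof.
have P0 : has_path G u u 0 by apply/existsP; exists [tuple]; rewrite /= eqxx.
rewrite /dist; case: pselect => [e|[]]; last by exists 0.
case: ex_minnP => m _ /(_ _ P0); by rewrite leqn0 => /eqP ->.
Qed.

Section DistanceOperator.
Variables (V : finType) (k : nat) (hk : 1 < k).

Definition dist_adj (G : sgraph V) : rel V :=
  fun u v => dist G u v == Some k.

Lemma dist_adj_sym (G : sgraph V) : symmetric (dist_adj G).
Proof. by move=> u v; rewrite /dist_adj dist_sym. Qed.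

Lemma dist_adj_irr (G : sgraph V) : irreflexive (dist_adj G).
Proof. by move=> u; rewrite /dist_adj dist_refl; case: k hk. Qed.

Definition dist_op (G : sgraph V) : sgraph V :=
  SGraph (dist_adj_sym G) (dist_adj_irr G).

(* Indexing starts at 1: [dist_seq G 1] is [G], and [dist_seq G t] applies
   the operator t - 1 times; the value at t = 0 is never used. *)
Definition dist_seq (G : sgraph V) (t : nat) : sgraph V := iter t.-1 dist_op G.

Definition weak_periodicity (G : sgraph V) : nat :=
  match pselect (exists f, (1 < f) &&
                   labeled_iso (dist_seq G f) (dist_seq G 1)) with
  | left ex => ex_minn ex - 1
  | right _ => 0
  end.

End DistanceOperator.

(* [ordS] is the successor modulo n.  The conjunct [i != j] is vacuous as soon
   as n > 1; it only serves to keep the definition total. *)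
Definition cycle_adj (n : nat) : rel 'I_n :=
  fun i j => (i != j) && ((ordS i == j) || (ordS j == i)).

Lemma cycle_adj_sym (n : nat) : symmetric (@cycle_adj n).
Proof. by move=> i j; rewrite /cycle_adj eq_sym orbC. Qed.

Lemma cycle_adj_irr (n : nat) : irreflexive (@cycle_adj n).
Proof. by move=> i; rewrite /cycle_adj eqxx. Qed.

Definition cycle_graph (n : nat) : sgraph 'I_n :=
  SGraph (@cycle_adj_sym n) (@cycle_adj_irr n).

(* Main.v *)
Require Import Defs.
From mathcomp Require Import all_boot.
From mathcomp Require Import boolp zify.

Set Implicit Arguments.
Unset Strict Implicit.
Unset Printing Implicit Defensive.

(** Write n = k^p + 1. When s is prime to n, the circulant graph on Z/n with
    connection set {s, -s} is a cycle, and since 2k < n its pairs at distance k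
    are those differing by ks or -ks. Hence the t-th iterate of D^k on C_n is
    the circulant graph with connection set {k^t, -k^t}, which is C_n exactly
    when k^t = 1 or k^t = -1 modulo n. This holds for t = p and, as
    1 < k^t < n - 1, for no t with 0 < t < p. *)

Lemma dist_eqP (V : finType) (G : sgraph V) (u v : V) (m : nat) :
  reflect (has_path G u v m /\ forall i, has_path G u v i -> m <= i)
          (dist G u v == Some m).
Proof.
rewrite /dist; case: pselect => [ex|nex]; last first.
  by constructor=> -[Pm _]; apply: nex; exists m.
case: ex_minnP => i Pi mini; apply: (iffP eqP) => [[<-]//|[Pm minm]].
by congr Some; apply/eqP; rewrite eqn_leq mini ?minm.
Qed.

(** The difference of the endpoints is s or -s modulo n; two sums replace the negative residue. *)
Definition circulant_adj (n s : nat) : rel 'I_n :=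
  fun u v => (u + s == v %[mod n]) || (v + s == u %[mod n]).

Section Circulant.
Variables (n s : nat) (G : sgraph 'I_n).
Hypotheses (Gs : G =2 @circulant_adj n s) (cop : coprime n s).

(** Here [a] counts the steps +s and [b] the steps -s; keeping them on opposite sides avoids
    subtraction. *)
Lemma walk_displacement (u : 'I_n) (t : seq 'I_n) : path G u t ->
  exists a b, a + b = size t /\ last u t + b * s = u + a * s %[mod n].
Proof.
elim: t u => [|v t IH] u /=; first by exists 0, 0.
rewrite Gs => /andP[uv /IH[a [b [<- E]]]].
case/orP: uv => /eqP uv.
- exists a.+1, b; split=> //.
  by rewrite E mulSn addnA -modnDml -uv modnDml.
- exists a, b.+1; split; first by rewrite addnS.
  by rewrite mulSn addnCA addnC -modnDml E modnDml addnAC -modnDml uv modnDml.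
Qed.

(** The path is u, u + s, ..., u + ms; it repeats no vertex because s is invertible modulo n and m <
    n. *)
Lemma has_path_displacement (u v : 'I_n) (m : nat) :
  m < n -> v = u + m * s %[mod n] -> has_path G u v m.
Proof.
move=> mn E.
have n0 : 0 < n by apply: leq_ltn_trans mn.
pose f (x : 'I_n) : 'I_n := Ordinal (ltn_pmod (x + s) n0).
have iterE i : iter i f u = (u + i * s) %% n :> nat.
  elim: i => [|i IH] /=; first by rewrite addn0 modn_small.
  by rewrite IH modnDml mulSn addnA addnAC.
have sz : size (traject f (f u) m) == m by rewrite size_traject.
apply/existsP; exists (Tuple sz); apply/and3P; split=> /=.
- apply: sub_path (fpath_traject f u m) => x y /= /eqP <-.
  by rewrite Gs /circulant_adj /= modn_mod eqxx.
- by rewrite last_traject; apply/eqP/val_inj; rewrite /= iterE -E modn_small.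
(* A repetition would make the m-th iterate equal an i-th one with i < m, so n would divide (m -
   i)s, hence m - i. *)
- rewrite -[_ && _]/(uniq (traject f u m.+1)) looping_uniq.
  apply/negP=> /trajectP[i im /(congr1 val)] /=; rewrite !iterE => /eqP.
  rewrite eqn_modDl eqn_mod_dvd ?leq_mul2r ?(ltnW im) ?orbT //.
  rewrite -mulnBl Gauss_dvdl // => /dvdn_leq; rewrite subn_gt0 im => /(_ isT).
  by rewrite leqNgt (leq_ltn_trans (leq_subr _ _) mn).
Qed.

(** A walk with a + b < m steps would, after cancelling s, make n divide m + b - a, which lies
    strictly between 0 and 2m. *)
Lemma dist_displacement (u v : 'I_n) (m : nat) :
  m.*2 < n -> v = u + m * s %[mod n] -> dist G u v == Some m.
Proof.
move=> mn E; apply/dist_eqP; split.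
  by apply: has_path_displacement => //; lia.
move=> i /existsP[t /and3P[Gt /eqP tv _]].
have [a [b []]] := walk_displacement Gt; rewrite tv size_tuple => ab.
rewrite leqNgt => Eab; apply/negP=> im; move: Eab.
rewrite -modnDml E modnDml -addnA -mulnDl => /eqP.
rewrite eqn_modDl eqn_mod_dvd; last by rewrite leq_mul2r; lia.
rewrite -mulnBl Gauss_dvdl // => /dvdn_leq; lia.
Qed.

Lemma dist_circulant (k : nat) (u v : 'I_n) :
  k.*2 < n -> (dist G u v == Some k) = @circulant_adj n (s * k) u v.
Proof.
move=> kn; apply/idP/idP; last first.
  case/orP=> /eqP E; last rewrite dist_sym;
    by apply: dist_displacement; rewrite // mulnC.
case/dist_eqP=> /existsP[t /and3P[Gt /eqP tv _]] mink.
have [a [b []]] := walk_displacement Gt; rewrite tv size_tuple => ab.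
rewrite /circulant_adj [s * k]mulnC.
(* Exchanging the endpoints exchanges forward and backward steps. *)
wlog ba : u v a b mink ab {t Gt tv} / b <= a.
  move=> W; case: (leqP b a) => [ba|/ltnW ba] E; first exact: (W u v a b).
  rewrite orbC; apply: (W v u b a) => //; last by rewrite addnC.
  by move=> i; rewrite has_path_sym; apply: mink.
rewrite -{1}(subnK ba) mulnDl addnA => /eqP; rewrite eqn_modDr => /eqP E.
(* Cancelling opposite steps leaves a path of length a - b; since a + b = k is minimal, b = 0. *)
have /mink : has_path G u v (a - b) by apply: has_path_displacement => //; lia.
move=> kab; have -> : k = a - b by lia.
by rewrite E eqxx.
Qed.

End Circulant.

Lemma cycle_graph_circulant (n : nat) :
  1 < n -> cycle_graph n =2 @circulant_adj n 1.
Proof.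
move=> n1 u v; rewrite /= /cycle_adj /circulant_adj.
have ordSE (x y : 'I_n) : (ordS x == y) = (x + 1 == y %[mod n]).
  by rewrite -val_eqE /= addn1 [y %% n]modn_small.
rewrite !ordSE; have [->|//] := eqVneq u v.
by rewrite orbb -[X in _ == X %[mod _]]addn0 eqn_modDl mod0n modn_small.
Qed.

(** Every k^t stays prime to n, so [dist_circulant] applies again at each stage. Index [t.+1] means
    t applications of the operator. *)
Lemma dist_seq_cycle (n k t : nat) (hk : 1 < k) :
  k.*2 < n -> coprime n k ->
  dist_seq hk (cycle_graph n) t.+1 =2 @circulant_adj n (k ^ t).
Proof.
move=> kn cop; elim: t => [|t IH] u v.
  by apply: cycle_graph_circulant; lia.
by rewrite expnSr; apply: (dist_circulant IH) => //; rewrite coprimeXr.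
Qed.

Lemma circulant_adj_eq1 (n s : nat) : 1 < n ->
  [forall u, forall v, @circulant_adj n s u v == @circulant_adj n 1 u v] =
  (s == 1 %[mod n]) || (s + 1 == 0 %[mod n]).
Proof.
move=> n1; have n0 := ltnW n1.
(* When s = -1 the two disjuncts of the adjacency trade places. *)
have E (x y : nat) : s + 1 = 0 %[mod n] ->
  (x + s == y %[mod n]) = (y + 1 == x %[mod n]).
  move=> s1; rewrite -(eqn_modDr 1) -addnA -modnDmr s1 modnDmr addn0.
  by rewrite eq_sym.
apply/idP/idP.
(* The single edge between 0 and 1 already forces s to be 1 or -1. *)
- move/forallP/(_ (Ordinal n0))/forallP/(_ (Ordinal n1))/eqP.
  rewrite /circulant_adj /= !add0n eqxx /= addnC => /orP[]->//.
  by rewrite orbT.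
- case/orP=> /eqP s1; apply/forallP=> u; apply/forallP=> v; apply/eqP.
    by rewrite /circulant_adj -modnDmr s1 modnDmr -(modnDmr v s) s1 modnDmr.
  by rewrite /circulant_adj !E // orbC.
Qed.

Theorem theorem1 (k p : nat) (hk : 1 < k) (hp : 1 < p) :
  weak_periodicity hk (cycle_graph (k ^ p + 1)) = p.
Proof.
set n := k ^ p + 1.
have kp : k ^ 2 <= k ^ p by rewrite leq_exp2l.
(* The chain is 2k <= k^2 <= k^p < n, from k > 1 and p > 1. *)
have kn : k.*2 < n by rewrite /n; move: kp; rewrite -mulnn; nia.
have cop : coprime n k.
  by rewrite -(@coprime_pexpr p) ?(ltnW hp) // /n addn1 coprimeSn.
have iso t : labeled_iso (dist_seq hk (cycle_graph n) t.+1)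
                         (dist_seq hk (cycle_graph n) 1) =
             (k ^ t == 1 %[mod n]) || (k ^ t + 1 == 0 %[mod n]).
  rewrite -circulant_adj_eq1; last by lia.
  apply: eq_forallb => u; apply: eq_forallb => v.
  by rewrite dist_seq_cycle // (dist_seq_cycle 0).
(* At t = p the sum k^t + 1 is n itself, so the second congruence holds. *)
have isop : (1 < p.+1) && labeled_iso (dist_seq hk (cycle_graph n) p.+1)
                                      (dist_seq hk (cycle_graph n) 1).
  by rewrite iso modnn mod0n eqxx orbT ltnS ltnW.
rewrite /weak_periodicity; case: pselect => [ex|[]]; last by exists p.+1.
(* The least index is [t.+1], so the period is t, and minimality against [isop] gives t <= p. *)
case: ex_minnP => -[|t] // /andP[t0 isot] /(_ _ isop); rewrite ltnS => tp.
rewrite subn1 /=; apply/eqP; rewrite eqn_leq tp leqNgt /=; apply/negP=> ltp.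
have kt : 1 < k ^ t by rewrite -(exp1n t) ltn_exp2r.
have ktp : k ^ t < k ^ p by rewrite ltn_exp2l.
by move: isot; rewrite iso mod0n !modn_small /n; lia.
Qed.
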